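(* Let $h:\mathbb{R}^n\to(-\infty,\infty]$ be a proper, lower semicontinuous, convex function, let $A\in\mathbb{R}^{m\times n}$ and $b\in\mathbb{R}^m$, and assume that $\{x\in\mathbb{R}^n: Ax=b\}\neq\emptyset$. Consider the problem $$\text{(P)}\quad\text{minimize } h(x)\ \text{ subject to } Ax=b,$$ and its dual problem $$\text{(D)}\quad\text{maximize } d(y)\ \text{ subject to } y\in\mathbb{R}^m,\qquad d(y):=\inf_{x\in\mathbb{R}^n}\{h(x)+\langle y,Ax-b\rangle\}.$$ Put $g:=-d$. Let $\{x^k\}$, $\{y^k\}$ be sequences generated by the gradient-based inexact augmented Lagrangian method (GIALM, described in the context) with proximal parameter $\lambda>0$ and scaling factor $\mu>2$. Assume that $\sup_{y\in\mathbb{R}^m}d(y)>-\infty$ and that $y^k$ is not a solution to (D) for every $k\in\mathbb{N}$. Then either $\|y^k\|\to\infty$ as $k\to\infty$, or all of the following assertions hold: (i) Every accumulation point of $\{y^k\}$ is a solution to (D). If in addition the sequence $\{y^k\}$ is bounded, then every accumulation point of $\{x^k\}$ is a solution to (P). (ii) If the Moreau envelope $e_\lambda g$ satisfies the KL property at an accumulation point $\bar y$ of $\{y^k\}$, then $y^k\to\bar y$ as $k\to\infty$. (iii) If $e_\lambda g$ satisfies the KL property at an accumulation point $\bar y$ of $\{y^k\}$ with $\psi(t)=Mt^q$ for some $M>0$ and $q\in(0,1)$, then: - if $q\in(0,1/2]$, the sequence $\{y^k\}$ converges linearly to $\bar y$ as $k\to\infty$; - if $q\in(1/2,1)$, then $\|y^k-\bar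 y\|=\mathcal{O}\big(k^{-\frac{1-q}{2q-1}}\big)$ as $k\to\infty$.
   Context: $\|\cdot\|$ is the Euclidean norm and $\mathbb{N}=\{1,2,\dots\}$. The augmented Lagrangian of (P) is, for $\lambda>0$ and $(x,y)\in\mathbb{R}^n\times\mathbb{R}^m$, $$\mathcal{L}_\lambda(x,y):=h(x)+\langle y,Ax-b\rangle+\frac\lambda2\|Ax-b\|^2.$$ A solution to (P) is a feasible point minimizing $h$ over the feasible set; a solution to (D) is a maximizer of $d$ over $\mathbb{R}^m$. The function $g=-d$ is lower semicontinuous and convex, and for proper $g$ its Moreau envelope is $e_\lambda g(y)=\inf_{w\in\mathbb{R}^m}\{g(w)+\frac1{2\lambda}\|w-y\|^2\}$, which is $\mathcal{C}^1$-smooth on $\mathbb{R}^m$. GIALM algorithm. Step 0: choose a starting point $y^1\in\mathbb{R}^m$, a proximal parameter $\lambda>0$, an initial error $\varepsilon_1>0$, an error reduction factor $\theta\in(0,1)$ and a scaling factor $\mu>2$; set $k:=1$. Step 1: find $x^{k+1}\in\mathbb{R}^n$ and the smallest integer $i_k\in\{0,1,2,\dots\}$ such that $$\mathcal{L}_\lambda(x^{k+1},y^k)-\inf_{x\in\mathbb{R}^n}\mathcal{L}_\lambda(x,y^k)\le\frac{\lambda\theta^{2i_k}\varepsilon_k^2}{2}\quad\text{and}\quad\|b-Ax^{k+1}\|>\mu\,\theta^{i_k}\varepsilon_k.$$ Step 2: set $y^{k+1}:=y^k+\lambda(Ax^{k+1}-b)$ and $\varepsilon_{k+1}:=\theta^{i_k}\varepsilon_k$;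 increase $k$ by $1$ and go back to Step 1. (So the sequence $\{x^k\}$ is indexed by $k\ge2$.) Step 1 is performed as follows: start with $i_k=0$ and choose some $x^{k+1}$ satisfying the first inequality; as long as the second inequality fails, increase $i_k$ by $1$ and choose again some $x^{k+1}$ satisfying the first inequality with the new $i_k$; ''smallest'' refers to the first value of $i_k$ at which this procedure stops. (The procedure stops after finitely many trials when $g$ is proper and $y^k$ is not a solution to (D).) KL property: a differentiable function $f:\mathbb{R}^m\to\mathbb{R}$ satisfies the KL (Kurdyka-Łojasiewicz) property at $\bar y\in\mathbb{R}^m$ if there exist a number $\eta>0$, a neighborhood $U$ of $\bar y$, and a nondecreasing function $\psi:(0,\eta)\to(0,\infty)$ such that $1/\psi$ is integrable over $(0,\eta)$ and $$\|\nabla f(y)\|\ge\psi\big(f(y)-f(\bar y)\big)\quad\text{for all }y\in U\text{ with }f(\bar y)<f(y)<f(\bar y)+\eta.$$ ''KL property at $\bar y$ with $\psi(t)=Mt^q$'' means that this holds with that particular function $\psi$ (for some $\eta>0$ and some neighborhood $U$). A sequence $\{z^k\}$ converges linearly to $\bar z$ if there are $c>0$ and $t\in(0,1)$ with $\|z^k-\bar z\|\le c\,t^k$ for all sufficiently large $k$. *)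

(* Defs.v *)
From HB Require Import structures.
From mathcomp Require Import all_boot all_order all_algebra.
From mathcomp Require Import all_classical all_reals all_analysis.
Import Order.TTheory GRing.Theory Num.Theory.
Import numFieldNormedType.Exports.

Set Implicit Arguments.
Unset Strict Implicit.
Unset Printing Implicit Defensive.

Local Open Scope classical_set_scope.
Local Open Scope ring_scope.

Definition inner {R : realType} {n : nat} (u v : 'cV[R]_n) : R :=
  \sum_(i < n) u i 0 * v i 0.

(* The library norm `|u| on matrices is the max norm, not this one; the two
   induce the same topology, so convergence, neighbourhoods, cluster points
   and derivatives are those of the library. *)
Definition enorm {R : realType} {n : nat} (u : 'cV[R]_n) : R :=
  Num.sqrt (inner u u).

Definition proper_fun {R : realType} {n : nat} (f : 'cV[R]_n -> \bar R) : Prop :=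
  (forall x, -oo < f x)%E /\ (exists x, f x < +oo)%E.

(* For f with values in ]-oo, +oo], no undefined sum occurs; at t = 0 or 1 the
   library convention 0 * +oo = 0 makes the inequality trivial. *)
Definition convex_efun {R : realType} {n : nat} (f : 'cV[R]_n -> \bar R) : Prop :=
  forall (x y : 'cV[R]_n) (t : R), 0 <= t <= 1 ->
    (f (t *: x + (1 - t) *: y)%R <= t%:E * f x + (1 - t)%:E * f y)%E.

Section problem.
Context {R : realType} {n m : nat}.
Variables (h : 'cV[R]_n -> \bar R) (A : 'M[R]_(m, n)) (b : 'cV[R]_m).

Definition primal_solution (x : 'cV[R]_n) : Prop :=
  A *m x = b /\ forall z, A *m z = b -> (h x <= h z)%E.

Definition dual (y : 'cV[R]_m) : \bar R :=
  ereal_inf [set (h x + (inner y (A *m x - b)%R)%:E)%E | x in [set: 'cV[R]_n]].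

Definition dual_solution (y : 'cV[R]_m) : Prop :=
  forall w, (dual w <= dual y)%E.

Definition aug_lagrangian (lambda : R) (x : 'cV[R]_n) (y : 'cV[R]_m) : \bar R :=
  (h x + (inner y (A *m x - b)%R)%:E
       + (lambda / 2 * enorm (A *m x - b) ^+ 2)%R%:E)%E.

Definition approx_minimizer (lambda : R) (y : 'cV[R]_m) (delta : R)
    (x : 'cV[R]_n) : Prop :=
  (aug_lagrangian lambda x y
   - ereal_inf [set aug_lagrangian lambda z y | z in [set: 'cV[R]_n]]
   <= delta%:E)%E.

(* [z j] is the trial point chosen for the value j of the inner counter; the
   inner loop stops at the first j = i for which the lower bound on the
   residual of [z j] holds, and returns [z i]. *)
Definition gialm_step1 (lambda theta mu : R) (y : 'cV[R]_m) (eps : R)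
    (i : nat) (x' : 'cV[R]_n) : Prop :=
  exists z : nat -> 'cV[R]_n,
    [/\ forall j, (j <= i)%N ->
          approx_minimizer lambda y
            (lambda * theta ^+ (2 * j) * eps ^+ 2 / 2) (z j),
        forall j, (j < i)%N ->
          ~ (enorm (b - A *m z j) > mu * theta ^+ j * eps),
        enorm (b - A *m z i) > mu * theta ^+ i * eps
      & x' = z i].

(* Indices start at 1 for y and eps and at 2 for x; the values y 0, eps 0,
   x 0 and x 1 are irrelevant. *)
Record gialm (lambda theta mu : R) (x : nat -> 'cV[R]_n)
    (y : nat -> 'cV[R]_m) (eps : nat -> R) (i : nat -> nat) : Prop := Gialm {
  gialm_lambda : 0 < lambda ;
  gialm_theta : 0 < theta < 1 ;
  gialm_mu : 2 < mu ;
  gialm_eps1 : 0 < eps 1%N ;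
  gialm_x : forall k, (1 <= k)%N ->
    gialm_step1 lambda theta mu (y k) (eps k) (i k) (x k.+1) ;
  gialm_y : forall k, (1 <= k)%N ->
    y k.+1 = y k + lambda *: (A *m x k.+1 - b) ;
  gialm_eps : forall k, (1 <= k)%N -> eps k.+1 = theta ^+ i k * eps k }.

End problem.

Definition moreau {R : realType} {m : nat} (lambda : R)
    (g : 'cV[R]_m -> \bar R) (y : 'cV[R]_m) : \bar R :=
  ereal_inf [set (g w + ((2 * lambda)^-1 * enorm (w - y) ^+ 2)%R%:E)%E
            | w in [set: 'cV[R]_m]].

Definition gradient {R : realType} {m : nat} (f : 'cV[R]_m -> R)
    (y : 'cV[R]_m) : 'cV[R]_m :=
  \col_(i < m) 'D_(delta_mx i 0) f y.

(* Meant for differentiable f. *)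
Definition KL_with {R : realType} {m : nat} (f : 'cV[R]_m -> R)
    (ybar : 'cV[R]_m) (psi : R -> R) : Prop :=
  exists (eta : R) (U : set 'cV[R]_m),
    [/\ 0 < eta, nbhs ybar U,
        (forall t, 0 < t < eta -> 0 < psi t) /\
        (forall s t, 0 < s -> s <= t -> t < eta -> psi s <= psi t),
        (@lebesgue_measure R).-integrable `]0, eta[
          (fun t => ((psi t)^-1)%:E)
      & forall y, U y -> f ybar < f y < f ybar + eta ->
          psi (f y - f ybar) <= enorm (gradient f y)].

Definition KL_property {R : realType} {m : nat} (f : 'cV[R]_m -> R)
    (ybar : 'cV[R]_m) : Prop :=
  exists psi : R -> R, KL_with f ybar psi.

Definition accumulation_point {R : realType} {n : nat} (u : nat -> 'cV[R]_n)
    (ubar : 'cV[R]_n) : Prop :=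
  cluster (u @ \oo) ubar.

Definition converges_linearly {R : realType} {n : nat} (u : nat -> 'cV[R]_n)
    (ubar : 'cV[R]_n) : Prop :=
  exists c t : R, [/\ 0 < c, 0 < t < 1
    & \forall k \near \oo, enorm (u k - ubar) <= c * t ^+ k].

(* Main.v *)
(* The envelope F of the dual function satisfies
   F(y) = - inf_x L_lambda(x, y).  The Lagrangian L_lambda(., y) is strongly
   convex as a function of the residual Ax - b, so the residuals of a minimizing
   sequence converge to some u, and
     L_lambda(x, y) >= - F(y) + lambda/2 |Ax - b - u|^2   for every x.
   Put G(y) = -u.  This one inequality identifies F with the Moreau envelope,
   gives F(y) + <G y, z - y> <= F(z)
           <= F(y) + <G y, z - y> + |z - y|^2 / (2 lambda),
   so that G is the gradient of F, and bounds |(b - Ax) - G(y)|^2 by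
   2 delta / lambda when x is a delta-minimizer.  GIALM is therefore a gradient
   descent for F with step lambda and relative error below 1/2: F(y^k)
   decreases by a multiple of |b - A x^{k+1}|^2.  If y^k has an accumulation
   point ybar, then F(y^k) tends to F(ybar), the gradients tend to 0 and ybar
   minimizes F.  For a KL function psi, set Psi(t) to be the integral of 1/psi
   over ]0, t[; the steps |y^{k+1} - y^k| are at most a multiple of
   Psi(F(y^k) - F(ybar)) - Psi(F(y^{k+1}) - F(ybar)) as long as the iterates
   stay near ybar, and the telescoping sum keeps them there.  The rates come
   from r_{k+1} <= r_k - c psi(r_k)^2 for r_k = F(y^k) - F(ybar).
   The alternative |y^k| -> oo is never needed, since the remaining assertions
   all suppose an accumulation point or boundedness. *)
Require Import Defs.
From HB Require Import structures.
From mathcomp Require Import all_boot all_order all_algebra.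
From mathcomp Require Import all_classical all_reals all_analysis.
From mathcomp Require Import ring lra.
Import Order.TTheory GRing.Theory Num.Theory.
Import numFieldNormedType.Exports.

Set Implicit Arguments.
Unset Strict Implicit.
Unset Printing Implicit Defensive.

Local Open Scope classical_set_scope.
Local Open Scope ring_scope.

(** * Euclidean norm *)
Section euclidean_norm.
Context {R : realType} {n : nat}.
Implicit Types (u v w : 'cV[R]_n) (a : R).

Lemma innerC u v : inner u v = inner v u.
Proof. by apply: eq_bigr => i _; rewrite mulrC. Qed.

Lemma innerDl u v w : inner (u + v) w = inner u w + inner v w.
Proof. by rewrite -big_split; apply: eq_bigr => i _; rewrite mxE mulrDl. Qed.

Lemma innerZl a u v : inner (a *: u) v = a * inner u v.
Proof. by rewrite mulr_sumr; apply: eq_bigr => i _; rewrite mxE mulrA. Qed.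

Lemma innerNl u v : inner (- u) v = - inner u v.
Proof. by rewrite -scaleN1r innerZl mulN1r. Qed.

Lemma innerDr u v w : inner u (v + w) = inner u v + inner u w.
Proof. by rewrite innerC innerDl !(innerC u). Qed.

Lemma innerZr a u v : inner u (a *: v) = a * inner u v.
Proof. by rewrite innerC innerZl innerC. Qed.

Lemma innerNr u v : inner u (- v) = - inner u v.
Proof. by rewrite innerC innerNl innerC. Qed.

Definition innerE := (innerDl, innerDr, innerNl, innerNr, innerZl, innerZr).

Lemma inner_ge0 u : 0 <= inner u u.
Proof. by apply: sumr_ge0 => i _; rewrite -expr2 sqr_ge0. Qed.

Lemma enorm_sqr u : enorm u ^+ 2 = inner u u.
Proof. by rewrite sqr_sqrtr // inner_ge0. Qed.

Lemma enorm_ge0 u : 0 <= enorm u.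
Proof. exact: sqrtr_ge0. Qed.

Lemma enormZ a u : enorm (a *: u) = `|a| * enorm u.
Proof.
by rewrite /enorm innerZl innerZr mulrA -expr2 sqrtrM ?sqr_ge0// sqrtr_sqr.
Qed.

Lemma enormN u : enorm (- u) = enorm u.
Proof. by rewrite -scaleN1r enormZ normrN1 mul1r. Qed.

Lemma enormB u v : enorm (u - v) = enorm (v - u).
Proof. by rewrite -enormN opprB. Qed.

Lemma enorm0 : enorm (0 : 'cV[R]_n) = 0.
Proof. by rewrite -(scale0r 0) enormZ normr0 mul0r. Qed.

Lemma coord_le_enorm u i : `|u i 0| <= enorm u.
Proof.
rewrite -(@ler_pXn2r _ 2) ?nnegrE ?enorm_ge0// enorm_sqr real_normK ?num_real//.
by rewrite /inner (bigD1 i)//= -expr2 lerDl sumr_ge0// => j _; rewrite -expr2 sqr_ge0.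
Qed.

Lemma enorm_eq0 u : enorm u = 0 -> u = 0.
Proof.
move=> u0; apply/matrixP => i j; rewrite (ord1 j) mxE; apply/eqP.
by rewrite -normr_eq0 eq_le normr_ge0 andbT -u0 coord_le_enorm.
Qed.

Lemma inner_le_enorm u v : inner u v <= enorm u * enorm v.
Proof.
have [->|u0] := eqVneq u 0.
  by rewrite -(scale0r 0) innerZl mul0r mulr_ge0 ?enorm_ge0.
have [->|v0] := eqVneq v 0.
  by rewrite -(scale0r 0) innerZr mul0r mulr_ge0 ?enorm_ge0.
have pos w : w != 0 -> 0 < enorm w.
  by move=> w0; rewrite lt_def enorm_ge0 andbT; apply: contra_neq w0 => /enorm_eq0.
(* Expanding this square gives twice |u| |v| times (|u| |v| - <u, v>); dividing by the positive
   factor |u| |v| leaves the Cauchy-Schwarz inequality. *)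
have := inner_ge0 (enorm v *: u - enorm u *: v).
rewrite !innerE (innerC v u) -!enorm_sqr => H.
have {}H : 0 <= 2 * ((enorm u * enorm v) * (enorm u * enorm v - inner u v)) by nra.
move: H; rewrite !pmulr_rge0 ?mulr_gt0 ?pos// subr_ge0//.
Qed.

Lemma enorm_sqrD u v : enorm (u + v) ^+ 2 = enorm u ^+ 2 + 2 * inner u v + enorm v ^+ 2.
Proof. rewrite !enorm_sqr !innerE (innerC v u); ring. Qed.

Lemma enorm_sqrB u v : enorm (u - v) ^+ 2 = enorm u ^+ 2 - 2 * inner u v + enorm v ^+ 2.
Proof. by rewrite enorm_sqrD innerNr enormN mulrN. Qed.

Lemma inner_le_norm u v : `|inner u v| <= enorm u * enorm v.
Proof.
by rewrite ler_norml inner_le_enorm andbT lerNl -innerNl -(enormN u) inner_le_enorm.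
Qed.

Lemma ler_enormD u v : enorm (u + v) <= enorm u + enorm v.
Proof.
rewrite -(@ler_pXn2r _ 2) ?nnegrE ?addr_ge0 ?enorm_ge0// enorm_sqrD.
have := inner_le_enorm u v; nra.
Qed.

Lemma ler_enorm_distD w u v : enorm (u - v) <= enorm (u - w) + enorm (w - v).
Proof. by rewrite (le_trans _ (ler_enormD _ _))// addrA subrK. Qed.

(** The constant is crude but positive even when [n] is 0, so that radii can be divided by it in
    [nbhs_enormP]. *)
Lemma enorm_le_norm u : enorm u <= n.+1%:R * `|u|.
Proof.
rewrite -(@ler_pXn2r _ 2) ?nnegrE ?enorm_ge0 ?mulr_ge0// enorm_sqr.
have H i : u i 0 * u i 0 <= `|u| ^+ 2.
  rewrite -expr2 -[u i 0 ^+ 2]real_normK ?num_real// ler_pXn2r ?nnegrE//.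
  by rewrite [leRHS]mx_normrE (le_bigmax _ (fun ij => `|u ij.1 ij.2|) (i, 0)).
apply: le_trans (_ : n%:R * `|u| ^+ 2 <= _).
  rewrite -[n in n%:R]card_ord mulr_natl -sumr_const.
  exact: ler_sum.
rewrite exprMn ler_wpM2r ?sqr_ge0// -natrX ler_nat.
by rewrite (leq_trans (leqnSn n))// expnS leq_pmulr.
Qed.

Lemma norm_le_enorm u : `|u| <= enorm u.
Proof.
rewrite [leLHS]mx_normrE; apply: bigmax_le => [|[i j] _]; first exact: enorm_ge0.
by rewrite (ord1 j) coord_le_enorm.
Qed.

Lemma nbhs_enormP (a : 'cV[R]_n) (U : set 'cV[R]_n) :
  nbhs a U <-> exists2 e, 0 < e & forall v, enorm (v - a) < e -> U v.
Proof.
split.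
  move=> /nbhs_ballP[e /= e0]; rewrite -ball_normE => eU; exists e => // v va; apply: eU => /=.
  by rewrite distrC (le_lt_trans (norm_le_enorm _)).
move=> [e e0 eU]; apply/nbhs_ballP; exists (e / n.+1%:R) => /=; first by rewrite divr_gt0.
rewrite -ball_normE => v /=; rewrite ltr_pdivlMr// => va; apply: eU.
by rewrite enormB (le_lt_trans (enorm_le_norm _))// mulrC.
Qed.

Lemma cvg_enormP (u : nat -> 'cV[R]_n) (a : 'cV[R]_n) :
  u @ \oo --> a <->
  forall e, 0 < e -> exists N, forall k, (N <= k)%N -> enorm (u k - a) < e.
Proof.
split.
  move=> ua e e0.
  have /ua[N _ H] : nbhs a [set v | enorm (v - a) < e] by apply/nbhs_enormP; exists e.
  by exists N => k Nk; exact: H.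
move=> H U /nbhs_enormP[e /H[N uN] eU]; exists N => // k /= Nk.
exact/eU/uN.
Qed.

Lemma enorm_complete (u : nat -> 'cV[R]_n) :
  (forall e, 0 < e -> exists N, forall i j, (N <= i)%N -> (N <= j)%N ->
     enorm (u i - u j) < e) ->
  exists a : 'cV[R]_n, u @ \oo --> a.
Proof.
move=> cu; suff : cvg (u @ \oo) by exists (lim (u @ \oo)).
apply/cauchy_cvgP/cauchy_ballP => e /cu[N uN].
pose T := [set v | exists2 k, (N <= k)%N & v = u k].
have uT : (u @ \oo) T by exists N => // k /= Nk; exists k.
exists (T, T) => // -[v w] /= [[i Ni ->] [j Nj ->]]; rewrite -ball_normE /=.
exact: le_lt_trans (norm_le_enorm _) (uN _ _ Ni Nj).
Qed.

Lemma cluster_enormP (u : nat -> 'cV[R]_n) (a : 'cV[R]_n) :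
  cluster (u @ \oo) a ->
  forall e N, 0 < e -> exists2 k, (N <= k)%N & enorm (u k - a) < e.
Proof.
move=> ua e N e0.
have [] := ua [set v | exists2 k, (N <= k)%N & v = u k] [set v | enorm (v - a) < e].
- by exists N => // k /= Nk; exists k.
- by apply/nbhs_enormP; exists e.
- by move=> v [[k Nk ->] ?]; exists k.
Qed.

End euclidean_norm.

(** * The Moreau envelope of the dual function *)

(** Stands in for letting s tend to 0 in the limit arguments below; restricting to s < 1 allows s^2
    to be absorbed into s. *)
Lemma le0_of_le_small (R : realFieldType) (X C : R) :
  0 <= C -> (forall s, 0 < s < 1 -> X <= s * C) -> X <= 0.
Proof.
move=> C0 H; rewrite leNgt; apply/negP => X0.
(* With s at most X / (2 (C + 1)) the product s C is below X; adding 1 keeps the divisor positive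
   when C = 0. *)
have C1 : 0 < C + 1 by rewrite ltr_wpDl.
have XC : 0 < X / (2 * (C + 1)) by rewrite divr_gt0 ?mulr_gt0.
have s01 : 0 < Num.min 2^-1 (X / (2 * (C + 1))) < 1.
  by rewrite lt_min XC invr_gt0 ltr0n/= gt_min; apply/orP; left; lra.
have := H _ s01; apply/negP; rewrite -ltNge.
apply: le_lt_trans (_ : X / (2 * (C + 1)) * C < _).
  by rewrite ler_wpM2r// ge_min lexx orbT.
rewrite mulrAC ltr_pdivrMr ?mulr_gt0//; nra.
Qed.

(** The right-hand side is the square of |lambda p + q| divided by 2 lambda. *)
Lemma young_inner (R : realType) (m : nat) (lambda : R) (p q : 'cV[R]_m) : 0 < lambda ->
  0 <= lambda / 2 * enorm p ^+ 2 + inner q p + (2 * lambda)^-1 * enorm q ^+ 2.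
Proof.
move=> l0; have : 0 <= (2 * lambda)^-1 * enorm (lambda *: p + q) ^+ 2.
  by rewrite mulr_ge0 ?sqr_ge0// invr_ge0 mulr_ge0// ltW.
rewrite enorm_sqrD enormZ exprMn real_normK ?num_real// innerZl innerC.
by congr (_ <= _); field; rewrite gt_eqF.
Qed.

(** Along a basis vector the two bounds squeeze F(y + t d) - F(y) - t <G y, d> between 0 and c t^2,
    so the difference quotient is within |c| |t| of its limit. *)
Lemma gradient_of_quadratic_bounds (R : realType) (m : nat)
    (F : 'cV[R]_m -> R) (G : 'cV[R]_m -> 'cV[R]_m) (c : R) (y : 'cV[R]_m) :
  (forall z, F y + inner (G y) (z - y) <= F z) ->
  (forall z, F z <= F y + inner (G y) (z - y) + c * enorm (z - y) ^+ 2) ->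
  gradient F y = G y.
Proof.
move=> lo up; apply/matrixP => i j; rewrite (ord1 j) mxE.
apply: cvg_lim => //; apply/cvgrPdist_lt => e e0.
have Gi : inner (G y) (delta_mx i 0) = G y i 0.
  rewrite /inner (bigD1 i)//= big1 ?addr0 => [|k ki]; first by rewrite mxE !eqxx mulr1.
  by rewrite mxE (negbTE ki) mulr0.
have d1 : enorm (delta_mx i 0 : 'cV[R]_m) ^+ 2 = 1.
  rewrite enorm_sqr /inner (bigD1 i)//= big1 ?addr0 => [|k ki].
    by rewrite mxE !eqxx mulr1.
  by rewrite mxE (negbTE ki) mulr0.
have c0 : 0 < `|c| + 1 by rewrite ltr_wpDl.
near=> t.
have t0 : t != 0 by near: t; exact: nbhs_dnbhs_neq.
have te : `|t| < e / (`|c| + 1) by near: t; apply: dnbhs0_lt; rewrite divr_gt0.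
rewrite /=.
have := lo (t *: delta_mx i 0 + y); have := up (t *: delta_mx i 0 + y).
rewrite addrK innerZr Gi enormZ exprMn d1 mulr1 real_normK ?num_real//.
set d := F _; move=> up' lo'.
have -> : G y i 0 - t^-1 *: (d - F y) = - (t^-1 * (d - F y - t * G y i 0)).
  by rewrite /GRing.scale/=; field.
rewrite normrN normrM normfV ltr_pdivrMl ?normr_gt0//.
apply: le_lt_trans (_ : `|c| * `|t| ^+ 2 < _).
  rewrite real_normK ?num_real//.
  have := ler_norm c; have := sqr_ge0 t => h1 h2; rewrite ger0_norm; first by nra.
  lra.
rewrite expr2 mulrA (mulrC _ `|t|) ltr_pM2l ?normr_gt0//.
apply: le_lt_trans (_ : (`|c| + 1) * `|t| < _); last by rewrite mulrC -ltr_pdivlMr.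
by rewrite ler_wpM2r// lerDl.
Unshelve. all: by end_near. Qed.

Section augmented_lagrangian.
Context {R : realType} {n m : nat}.
Variables (h : 'cV[R]_n -> \bar R) (A : 'M[R]_(m, n)) (b : 'cV[R]_m) (lambda : R).
Hypotheses (h_proper : proper_fun h) (h_convex : convex_efun h).
Hypothesis lambda_gt0 : 0 < lambda.
Hypothesis dual_proper : (-oo < ereal_sup (range (dual h A b)))%E.

Local Notation dom x := (h x < +oo)%E.
Local Notation res x := (A *m x - b).
Local Notation L y x := (aug_lagrangian h A b lambda x y).
Local Notation V y := (ereal_inf [set L y z | z in [set: 'cV[R]_n]]).

(** Represents the augmented Lagrangian on the domain of [h] only: elsewhere [fine] turns +oo into
    0. *)
Let lag (y : 'cV[R]_m) (x : 'cV[R]_n) : R :=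
  fine (h x) + inner y (res x) + lambda / 2 * enorm (res x) ^+ 2.

Let hE x : dom x -> h x = (fine (h x))%:E.
Proof. by move=> dx; rewrite fineK// fin_real// h_proper.1. Qed.

Let lagE y x : dom x -> L y x = (lag y x)%:E.
Proof. by move=> dx; rewrite /aug_lagrangian (hE dx). Qed.

Let lag_infty y x : ~ dom x -> L y x = +oo%E.
Proof. by move=> /negP; rewrite -leNgt leye_eq /aug_lagrangian => /eqP ->. Qed.

Let lag_dom y x : (L y x < +oo)%E -> dom x.
Proof. by apply: contraPT => /negP/lag_infty ->. Qed.

(** Convexity of [h] is combined with the exact identity |t u + (1 - t) v|^2 = t |u|^2 + (1 - t)
    |v|^2 - t (1 - t) |u - v|^2 for the residuals. *)
Let lag_convex y x z t : dom x -> dom z -> 0 <= t <= 1 ->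
  let c := t *: x + (1 - t) *: z in
  dom c /\ lag y c <= t * lag y x + (1 - t) * lag y z
                      - lambda / 2 * (t * (1 - t)) * enorm (res x - res z) ^+ 2.
Proof.
move=> dx dz t01 c; have := h_convex x z t01.
rewrite -/c (hE dx) (hE dz) -!EFinM -EFinD => hc.
have dc : dom c by rewrite (le_lt_trans hc)// ltry.
split=> //; move: hc; rewrite (hE dc) lee_fin => hc.
have rc : res c = t *: res x + (1 - t) *: res z.
  rewrite /c mulmxDr -!scalemxAr !scalerBr addrACA -opprD -scalerDl.
  have -> : t + (1 - t) = 1 by ring.
  by rewrite scale1r.
rewrite /lag rc; move: hc (res x) (res z) => + u v.
rewrite !enorm_sqr !innerE (innerC v u).
move: (fine (h x)) (fine (h z)) (fine (h c)) (inner y u) (inner y v) (inner u u).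
move: (inner u v) (inner v v) => s q hx hz hc p p' r; nra.
Qed.

Let dual_le y x : (dual h A b y <= h x + (inner y (res x))%:E)%E.
Proof. by apply: ereal_inf_lbound; exists x. Qed.

(** Weak duality at w, with <w - y, Ax - b> split by Young's inequality. It yields both the
    finiteness of the infimum and one half of its identification with the Moreau envelope. *)
Let dual_minorant y w x : dom x ->
  (dual h A b w - ((2 * lambda)^-1 * enorm (w - y) ^+ 2)%:E <= (lag y x)%:E)%E.
Proof.
move=> dx; have := dual_le w x; rewrite (hE dx) -EFinD.
case: (dual h A b w) => [d| |] //=; last by rewrite addNye !leNye.
rewrite -EFinD !lee_fin /lag => dle.
have := young_inner (res x) (y - w) lambda_gt0.
rewrite (enormB y) innerDl innerNl; lra.
Qed.

Let inf_fin y : V y \is a fin_num.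
Proof.
apply/fin_numP; split.
  have [_ [w _ <-] dw] := ereal_sup_gt dual_proper.
  have : (dual h A b w - ((2 * lambda)^-1 * enorm (w - y) ^+ 2)%:E <= V y)%E.
    apply/ereal_infP => _ [x _ <-].
    have [dx|dx] := pselect (dom x); last by rewrite lag_infty// leey.
    by rewrite lagE//; exact: dual_minorant.
  move=> le; apply/eqP => Vy; move: le; rewrite Vy leeNy_eq.
  by case: (dual h A b w) dw.
have [x dx] := h_proper.2.
rewrite -ltey; apply: le_lt_trans (ltry (lag y x)).
by rewrite -lagE//; apply: ereal_inf_lbound; exists x.
Qed.

Let inf_le y x : dom x -> fine (V y) <= lag y x.
Proof.
by move=> dx; rewrite -lee_fin fineK// -lagE//; apply: ereal_inf_lbound; exists x.
Qed.

Let inf_adherent y e : 0 < e -> exists2 x, dom x & lag y x < fine (V y) + e.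
Proof.
move=> e0; have [_ [x _ <-]] := lb_ereal_inf_adherent e0 (inf_fin y).
rewrite -(fineK (inf_fin y)) -EFinD => Lx.
have dx : dom x by apply: lag_dom (lt_trans Lx (ltry _)).
by exists x => //; move: Lx; rewrite lagE// lte_fin.
Qed.

(* The residuals of a minimizing sequence converge because [lag y] is strongly
   convex as a function of the residual; [u] is their limit. *)
Let residual_min y : exists u, forall x, dom x ->
  fine (V y) + lambda / 2 * enorm (res x - u) ^+ 2 <= lag y x.
Proof.
set v := fine (V y).
have /choice[z zP] : forall j : nat, exists z, dom z /\ lag y z < v + j.+1%:R^-1.
  move=> j; have [|z dz lz] := @inf_adherent y j.+1%:R^-1; first by rewrite invr_gt0.
  by exists z.
have small (e : R) : 0 < e -> exists N, forall j, (N <= j)%N -> j.+1%:R^-1 < e.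
  move=> e0; have [N _ H] := near_infty_natSinv_lt (PosNum e0).
  by exists N => j /H.
have [|u uP] := @enorm_complete _ _ (fun j => res (z j)).
  move=> e e0.
  (* At the midpoint, strong convexity gains lambda/2 times 1/4 of the squared distance of the
     residuals, hence the factor lambda/8. *)
  have [|N NP] := small (lambda / 8 * e ^+ 2); first by rewrite mulr_gt0 ?exprn_gt0 ?divr_gt0.
  exists N => i j /NP Ni /NP Nj /=.
  have [di li] := zP i; have [dj lj] := zP j.
  have half : 0 <= (2^-1 : R) <= 1 by apply/andP; split; lra.
  have [dc] := lag_convex y di dj half.
  have := inf_le y dc; rewrite -/v; set c := lag y _ => vc cle.
  rewrite -(@ltr_pXn2r _ 2) ?nnegrE ?enorm_ge0 ?(ltW e0)//.
  rewrite -(@ltr_pM2l _ (lambda / 8)) ?divr_gt0//.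
  move: (enorm _ ^+ 2) cle => D cle.
  move: (lag y (z i)) (lag y (z j)) (i.+1%:R^-1) (j.+1%:R^-1) Ni Nj li lj cle => p q r s.
  move: (lambda / 8 * e ^+ 2) => E; lra.
(* Compare the infimum v with the value at (1 - e) z_j + e x, divide by e and let e tend to 0. The
   index j is taken so large that z_j is optimal up to e^2, an error that is still of order e after
   the division, and that its residual is within e of u. *)
exists u => x dx; rewrite -subr_le0.
set a := enorm (res x - u); set X := (X in X <= 0).
have a0 : 0 <= a by exact: enorm_ge0.
apply: (@le0_of_le_small _ _ (1 + lambda / 2 * (a ^+ 2 + 2 * a))).
  by rewrite addr_ge0 ?mulr_ge0 ?divr_ge0 ?addr_ge0 ?sqr_ge0 ?mulr_ge0// ltW.
move=> e /andP[e0 e1].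
have [|N1 N1P] := small (e ^+ 2); first exact: exprn_gt0.
have [N2 N2P] := (cvg_enormP _ _).1 uP e e0.
have {N1P}Nj := N1P _ (leq_maxl N1 N2); have {N2P}Nu := N2P _ (leq_maxr N1 N2).
have [dj lj] := zP (maxn N1 N2); move: Nj Nu dj lj; move: (maxn N1 N2) => j Nj Nu dj lj.
have t01 : 0 <= 1 - e <= 1 by rewrite subr_ge0 (ltW e1) gerBl (ltW e0).
have [dc] := lag_convex y dj dx t01.
have := inf_le y dc; rewrite -/v; set c := lag y _ => vc cle.
set d := enorm (res (z j) - res x) in cle.
have da : a - e <= d.
  have := ler_enorm_distD (res (z j)) (res x) u.
  by rewrite -/a (enormB (res x) (res (z j))) -/d; lra.
have d2 : a ^+ 2 - 2 * a * e <= d ^+ 2.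
  have d0 : 0 <= d by exact: enorm_ge0.
  have [ae|ae] := leP e a; first nra.
  nra.
have {lj Nj}lj : (1 - e) * lag y (z j) <= (1 - e) * (v + e ^+ 2).
  by rewrite ler_wpM2l ?subr_ge0 ?(ltW e1)// (ltW (lt_trans lj _))// ltrD2l.
have e3 : 0 <= e ^+ 3 by rewrite exprn_ge0// ltW.
have {lj}cle : e * (v - e + lambda / 2 * (1 - e) * d ^+ 2) <= e * lag y x.
  move: cle lj vc; move: (lag y x) (lag y (z j)) => p q; lra.
move: cle; rewrite ler_pM2l// => cle.
have : lambda / 2 * (1 - e) * (a ^+ 2 - 2 * a * e) <= lambda / 2 * (1 - e) * d ^+ 2.
  by rewrite ler_wpM2l// mulr_ge0 ?divr_ge0 ?(ltW lambda_gt0)//; lra.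
rewrite /X => H.
have : 0 <= lambda / 2 * (e * e * (2 * a)).
  by rewrite !mulr_ge0 ?invr_ge0// ltW.
lra.
Qed.

Lemma moreau_dual_smooth : exists G : 'cV[R]_m -> 'cV[R]_m,
  let F := fun w => fine (moreau lambda (fun w => - dual h A b w)%E w) in
  [/\ forall y z, F y + inner (G y) (z - y) <= F z,
      forall y z, F z <= F y + inner (G y) (z - y) + (2 * lambda)^-1 * enorm (z - y) ^+ 2,
      forall y, V y = (- F y)%:E,
      forall y x delta, approx_minimizer h A b lambda y delta x ->
        enorm (b - A *m x - G y) ^+ 2 <= 2 * delta / lambda
    & forall y, (forall z, F y <= F z) -> dual_solution h A b y].
Proof.
have /choice[U UP] := residual_min.
(* Completing the square in [UP] turns the multiplier y into y + lambda U y, the proximal point at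
   which the Moreau infimum is attained. *)
have d0 y : ((fine (V y))%:E + (lambda / 2 * enorm (U y) ^+ 2)%:E
    <= dual h A b (y + lambda *: U y))%E.
  apply/ereal_infP => _ [x _ <-].
  have [dx|dx] := pselect (dom x); last first.
    by move: dx => /negP; rewrite -leNgt leye_eq => /eqP ->; rewrite leey.
  rewrite (hE dx) -!EFinD lee_fin; have := UP y x dx; rewrite /lag enorm_sqrB.
  rewrite innerDl innerZl (innerC (U y)); lra.
have MV y : moreau lambda (fun w => - dual h A b w)%E y = (- fine (V y))%:E.
  apply/eqP; rewrite eq_le; apply/andP; split.
    (* At the proximal point the penalty equals lambda/2 |U y|^2, which [d0] compensates; the
       reverse inequality is weak duality. *)
    apply: le_trans (ereal_inf_lbound _) _; first by exists (y + lambda *: U y).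
    rewrite addrAC subrr add0r enormZ exprMn real_normK ?num_real//.
    have := d0 y; have [x dx _] := inf_adherent y ltr01.
    have := dual_le (y + lambda *: U y) x; rewrite (hE dx) -EFinD.
    case: (dual h A b _) => [d| |] //= _.
    rewrite -!EFinD !lee_fin => H.
    have -> : (2 * lambda)^-1 * (lambda ^+ 2 * enorm (U y) ^+ 2) = lambda / 2 * enorm (U y) ^+ 2.
      by field; rewrite gt_eqF.
    lra.
  apply/ereal_infP => _ [w _ <-].
  rewrite EFinN leeNl fin_num_oppeD// oppeK.
  rewrite fineK//; apply/ereal_infP => _ [x _ <-].
  have [dx|dx] := pselect (dom x); last by rewrite lag_infty// leey.
  rewrite lagE//; exact: dual_minorant.
exists (fun y => - U y) => F.
have FE y : F y = - fine (V y) by rewrite /F MV.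
have lagD y z x : lag z x = lag y x + inner (z - y) (res x).
  by rewrite /lag innerDl innerNl; ring.
(* A point x optimal at y up to lambda/2 s^2 has its residual within s of U y. As the Lagrangian is
   affine in the multiplier with slope the residual, its value at z is close to the wanted affine
   function. *)
have lo y z : F y + inner (- U y) (z - y) <= F z.
  rewrite !FE -subr_le0; apply: (@le0_of_le_small _ _ (lambda / 2 + enorm (z - y))).
    by rewrite addr_ge0 ?enorm_ge0 ?divr_ge0// ltW.
  move=> s /andP[s0 s1].
  have [|x dx lx] := @inf_adherent y (lambda / 2 * s ^+ 2).
    by rewrite mulr_gt0 ?exprn_gt0 ?divr_gt0.
  have := inf_le z dx; rewrite (lagD y).
  have := UP y x dx => Ux.
  have us : enorm (res x - U y) <= s.
    rewrite -(@ler_pXn2r _ 2) ?nnegrE ?enorm_ge0 ?(ltW s0)//.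
    by rewrite -(@ler_pM2l _ (lambda / 2)) ?divr_gt0//; lra.
  have := inner_le_enorm (z - y) (res x - U y).
  rewrite innerDr innerNr innerNl (innerC (U y)) => H1 H2.
  have : enorm (z - y) * enorm (res x - U y) <= enorm (z - y) * s.
    by rewrite ler_wpM2l ?enorm_ge0.
  have : lambda / 2 * s ^+ 2 <= lambda / 2 * s.
    by rewrite ler_wpM2l ?divr_ge0 ?(ltW lambda_gt0)//; nra.
  lra.
(* Here the quadratic term of [UP] is kept and absorbs <z - y, Ax - b - U y> by Young's
   inequality. *)
have up y z : F z <= F y + inner (- U y) (z - y) + (2 * lambda)^-1 * enorm (z - y) ^+ 2.
  rewrite !FE lerNl -lee_fin fineK//; apply/ereal_infP => _ [x _ <-].
  have [dx|dx] := pselect (dom x); last by rewrite lag_infty// leey.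
  rewrite lagE// lee_fin (lagD y); have := UP y x dx.
  have := young_inner (res x - U y) (z - y) lambda_gt0.
  rewrite (innerDr (z - y)) (innerNr (z - y)) (innerNl (U y)) (innerC (U y)).
  move: ((2 * lambda)^-1 * enorm (z - y) ^+ 2) => K; lra.
split=> //.
- by move=> y; rewrite FE opprK fineK.
- move=> y x delta; rewrite /approx_minimizer => ax.
  have dx : dom x.
    apply: (@lag_dom y); move: ax; rewrite -(fineK (inf_fin y)).
    by case: (L y x) => [r| |] //= _; rewrite ltry.
  move: ax; rewrite lagE// -(fineK (inf_fin y)) -EFinB lee_fin.
  rewrite opprK -enormN opprD opprB -/(res x).
  have := UP y x dx; rewrite ler_pdivlMr//; lra.
(* The upper bound at y + lambda U y would lower F by lambda/2 |U y|^2, so U y = 0. Then [d0] bounds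
   the infimum at y by the dual value at y, while the infimum at w dominates the dual value at w. *)
- move=> y Fy w.
  have U0 : U y = 0.
    apply: enorm_eq0; apply/eqP; rewrite -sqrf_eq0 eq_le sqr_ge0 andbT.
    have := le_trans (Fy (y + lambda *: U y)) (up y _).
    have -> : y + lambda *: U y - y = lambda *: U y by rewrite addrAC subrr add0r.
    rewrite innerZr innerNl -enorm_sqr enormZ exprMn real_normK ?num_real//.
    have -> : (2 * lambda)^-1 * (lambda ^+ 2 * enorm (U y) ^+ 2) = lambda / 2 * enorm (U y) ^+ 2.
      by field; rewrite gt_eqF.
    by move=> H; rewrite -(@pmulr_rle0 _ (lambda / 2)) ?divr_gt0//; lra.
  have dV : (dual h A b w <= V w)%E.
    apply/ereal_infP => _ [x _ <-]; apply: le_trans (dual_le w x) _.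
    by rewrite /aug_lagrangian leeDl// lee_fin mulr_ge0 ?sqr_ge0 ?divr_ge0// ltW.
  apply: le_trans dV _; have := d0 y.
  rewrite U0 enorm0 expr0n mulr0 adde0 scaler0 addr0; apply: le_trans.
  by rewrite -(fineK (inf_fin w)) lee_fin; have := Fy w; rewrite !FE lerN2.
Qed.

End augmented_lagrangian.
(** * Rates and convergence of sequences *)

(** With u = s/r this is u^p <= 1 + p (u - 1), which is Young's inequality for u^p and 1 with
    exponents 1/p and 1/(1 - p). *)
Lemma powR_concave_tangent (R : realType) (p r s : R) :
  0 < p < 1 -> 0 < s -> s <= r ->
  p * (r - s) * r `^ (p - 1) <= r `^ p - s `^ p.
Proof.
move=> /andP[p0 p1] s0 sr; have r0 : 0 < r := lt_le_trans s0 sr.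
have u0 : 0 < s / r by rewrite divr_gt0.
have q0 : 0 < 1 - p by rewrite subr_gt0.
have H : (s / r) `^ p <= 1 + p * (s / r - 1).
  have := @conjugate_powR _ ((s / r) `^ p) 1 p^-1 (1 - p)^-1 (powR_ge0 _ _) ler01.
  rewrite !invr_gt0 !invrK subrKC => /(_ p0 q0 erefl).
  rewrite mulr1 -powRrM mulfV ?gt_eqF// powRr1 ?(ltW u0)// powR1.
  lra.
have -> : s `^ p = r `^ p * (s / r) `^ p.
  by rewrite -powRM ?(ltW r0) ?(ltW u0)// mulrCA mulfV ?gt_eqF// mulr1.
have -> : r `^ p = r * r `^ (p - 1) by rewrite mulr_powRB1// ltW.
have rr : 0 < r `^ (p - 1) by rewrite powR_gt0.
have -> : p * (r - s) * r `^ (p - 1) = r * r `^ (p - 1) * (p * (1 - s / r)).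
  by field; rewrite gt_eqF.
rewrite -{2}[r * _]mulr1 -mulrBr ler_pM2l ?mulr_gt0//; lra.
Qed.

(** With u = s/r it follows from u^(-p) = exp(-p ln u) >= 1 - p ln u and ln u <= u - 1. *)
Lemma powRN_convex_tangent (R : realType) (p r s : R) :
  0 < p -> 0 < s -> s <= r ->
  p * (r - s) * r `^ (- p - 1) <= s `^ (- p) - r `^ (- p).
Proof.
move=> p0 s0 sr; have r0 : 0 < r := lt_le_trans s0 sr.
have u0 : 0 < s / r by rewrite divr_gt0.
have H : 1 + p * (1 - s / r) <= (s / r) `^ (- p).
  rewrite /powR gt_eqF//; apply: le_trans (expR_ge1Dx _).
  rewrite lerD2l mulNr -mulrN ler_pM2l// lerNr opprB.
  have := @le_ln1Dx _ (s / r - 1); rewrite subrKC; apply.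
  lra.
have -> : s `^ (- p) = r `^ (- p) * (s / r) `^ (- p).
  by rewrite -powRM ?(ltW r0) ?(ltW u0)// mulrCA mulfV ?gt_eqF// mulr1.
have E : r `^ (- p) = r * r `^ (- p - 1).
  by rewrite powRB ?(gt_eqF r0) ?implybT// powRr1 ?(ltW r0)// mulrCA mulfV ?gt_eqF// mulr1.
rewrite E.
have rr : 0 < r `^ (- p - 1) by rewrite powR_gt0.
have -> : p * (r - s) * r `^ (- p - 1) = r * r `^ (- p - 1) * (p * (1 - s / r)).
  by field; rewrite gt_eqF.
rewrite -{3}[r * _]mulr1 -mulrBr ler_pM2l ?mulr_gt0//; lra.
Qed.

(** As [psi] may jump, the concavity of its integral is expressed by differences: on [s, t[ the
    integrand is at least 1/psi(t) by monotonicity. *)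
Lemma desingularizing_integral (R : realType) (eta : R) (psi : R -> R) :
  (forall t, 0 < t < eta -> 0 < psi t) ->
  (forall s t, 0 < s -> s <= t -> t < eta -> psi s <= psi t) ->
  (@lebesgue_measure R).-integrable `]0, eta[ (fun t => ((psi t)^-1)%:E) ->
  exists Psi : R -> R, (forall t, 0 < t < eta -> 0 <= Psi t) /\
    forall s t, 0 < s -> s <= t -> t < eta -> (t - s) / psi t <= Psi t - Psi s.
Proof.
move=> psi0 psi_nd psi_int.
pose f t := (psi t)^-1.
have mitv (i : interval R) : @measurable _ (measurableTypeR R) [set` i].
  exact: measurable_itv.
have sub (i : interval R) : [set` i] `<=` `]0, eta[ ->
    (@lebesgue_measure R).-integrable [set` i] (EFin \o f).
  by move=> ie; have := @integrableS _ (measurableTypeR R) R lebesgue_measure `]0, eta[ [set` i] _ (mitv _) (mitv _) ie psi_int.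
have itv0 t : 0 < t < eta -> `]0, t[ `<=` `]0, eta[.
  move=> /andP[t0 te] u /=; rewrite !in_itv/= => /andP[-> ut].
  exact: lt_trans ut te.
exists (fun t => \int[lebesgue_measure]_(u in `]0, t[) f u); split.
  move=> t t0; apply: Rintegral_ge0 => u.
  by move=> /(itv0 _ t0)/=; rewrite in_itv/= => /psi0/ltW; rewrite invr_ge0.
move=> s t s0 st te.
have t0 : 0 < t := lt_le_trans s0 st.
have sube : `[s, t[ `<=` `]0, eta[.
  move=> u /=; rewrite !in_itv/= => /andP[su ut].
  by rewrite (lt_le_trans s0 su) (lt_trans ut te).
have split_itv : `]0, t[%classic = `]0, s[%classic `|` `[s, t[%classic.
  by rewrite -itv_bndbnd_setU// bnd_simp.
rewrite [in leRHS]split_itv Rintegral_setU//=; last 2 first.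
- by rewrite -split_itv; apply: sub; apply: itv0; rewrite t0.
- apply/disj_setPRL => u /=; rewrite !in_itv/= => /andP[su _]; apply/negP.
  by rewrite negb_and -!leNgt su orbT.
rewrite addrAC subrr add0r.
have cE : \int[lebesgue_measure]_(u in `[s, t[) (psi t)^-1 = (t - s) / psi t.
  rewrite Rintegral_cst//= lebesgue_measure_itv/= lte_fin mulrC.
  by case: ltgtP st => // -> _; rewrite subrr.
have fu u : `[s, t[%classic u -> (psi t)^-1 <= f u.
  move=> /= itvu; have u0 := sube _ itvu; move: itvu u0; rewrite !in_itv/=.
  move=> /andP[su ut] /psi0 u0; rewrite /f lef_pV2 ?posrE//.
    by apply: psi_nd => //; [exact: lt_le_trans su|exact: ltW].
  by apply: psi0; rewrite t0.
rewrite -cE; apply: le_Rintegral => //=; last exact: sub.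
apply: (le_integrable (mitv _) _ _ (sub _ sube)).
  exact: measurable_cst.
move=> u /fu ftu /=.
rewrite lee_fin; apply: le_trans (ler_norm _).
by rewrite ger0_norm// invr_ge0 ltW// psi0// t0.
Qed.

(** Past N the sequence is within e of its infimum over the indices from K on, so j and k may come
    in either order. *)
Lemma nonincreasing_tail (R : realType) (p : nat -> R) (K : nat) (B : R) :
  (forall k, (K <= k)%N -> p k.+1 <= p k) ->
  (forall k, (K <= k)%N -> B <= p k) ->
  forall e, 0 < e -> exists2 N, (K <= N)%N &
    forall j k, (N <= j)%N -> (K <= k)%N -> p j - p k < e.
Proof.
move=> p_ni Bp e e0.
pose S := [set p k | k in [set k | (K <= k)%N]].
have Sinf : has_inf S.
  split; first by exists (p K), K => /=.
  by exists B => _ [k /= Kk <-]; exact: Bp.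
have [_ [N /= KN <-] pN] := inf_adherent e0 Sinf.
exists N => // j k Nj Kk.
have : p j <= p N.
  rewrite -(subnKC Nj); elim: (j - N)%N => [|d IH]; first by rewrite addn0.
  by rewrite addnS (le_trans _ IH)// p_ni// (leq_trans KN)// leq_addr.
have : inf S <= p k by apply: ge_inf; [exact: Sinf.2|exists k].
lra.
Qed.

(** The potential p pays for the steps inside the ball. Once an iterate is within e/2 of ybar and p
    can drop by less than e/2, induction keeps all later iterates within e. Summing the steps from k
    up to an index where y is again close to ybar bounds the distance by p k. *)
Lemma finite_length_trap (R : realType) (m : nat) (y : nat -> 'cV[R]_m)
    (ybar : 'cV[R]_m) (rho : R) (p : nat -> R) (K : nat) :
  0 < rho ->
  (forall k, (K <= k)%N -> 0 <= p k) ->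
  (forall k, (K <= k)%N -> p k.+1 <= p k) ->
  (forall k, (K <= k)%N -> enorm (y k - ybar) < rho ->
     enorm (y k.+1 - y k) <= p k - p k.+1) ->
  cluster (y @ \oo) ybar ->
  y @ \oo --> ybar /\
  exists N, forall k, (N <= k)%N -> enorm (y k - ybar) <= p k.
Proof.
move=> rho0 p0 p_ni step /cluster_enormP acc.
have trap e : 0 < e -> exists2 N, (K <= N)%N & forall k, (N <= k)%N -> enorm (y k - ybar) < e.
  (* For e above rho, the tail found for rho serves. *)
  wlog erho : e / e <= rho.
    move=> H e0; have [er|re] := leP e rho; first exact: H.
    have [N KN NP] := H rho (lexx _) rho0; exists N => // k /NP h.
    exact: lt_trans h re.
  move=> e0; have e20 : 0 < e / 2 by rewrite divr_gt0.
  have [N KN NP] := nonincreasing_tail p_ni p0 e20.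
  have [N' NN' yN'] := acc (e / 2) N e20.
  have KN' := leq_trans KN NN'.
  exists N' => // k Nk.
  have stay j : enorm (y (N' + j)%N - y N') <= p N' - p (N' + j)%N ->
      enorm (y (N' + j)%N - ybar) < e.
    have := NP N' (N' + j)%N NN' (leq_trans KN' (leq_addr _ _)).
    have := ler_enorm_distD (y N') (y (N' + j)%N) ybar.
    lra.
  rewrite -(subnKC Nk); apply: (stay); elim: (k - N')%N => [|j IH].
    by rewrite addn0 !subrr enorm0.
  have := step (N' + j)%N (leq_trans KN' (leq_addr _ _)) (lt_le_trans (stay _ IH) erho).
  rewrite addnS; have := ler_enorm_distD (y (N' + j)%N) (y (N' + j).+1) (y N').
  lra.
split; first by apply/cvg_enormP => e /trap[N _ NP]; exists N.
have [N KN NP] := trap rho rho0; exists N => k Nk.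
have Kk := leq_trans KN Nk.
have len j : enorm (y (k + j)%N - y k) <= p k - p (k + j)%N.
  elim: j => [|j IH]; first by rewrite addn0 !subrr enorm0.
  have := step (k + j)%N (leq_trans Kk (leq_addr _ _)) (NP _ (leq_trans Nk (leq_addr _ _))).
  rewrite addnS; have := ler_enorm_distD (y (k + j)%N) (y (k + j).+1) (y k).
  lra.
apply/ler_addgt0Pl => e e0.
have [j kj yj] := acc e k e0.
have := len (j - k)%N; rewrite subnKC//.
have := p0 j (leq_trans Kk kj); have := ler_enorm_distD (y j) (y k) ybar.
rewrite (enormB (y k) (y j)); lra.
Qed.

Lemma linear_rate (R : realType) (r : nat -> R) (c : R) (K : nat) :
  0 < c -> (forall k, (K <= k)%N -> 0 < r k) ->
  (forall k, (K <= k)%N -> r k.+1 <= r k - c * r k) ->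
  exists C t : R, [/\ 0 < C, 0 < t < 1 & forall k, (K <= k)%N -> r k <= C * t ^+ k].
Proof.
move=> c0 r0 dec.
(* Positivity of [r K.+1] forces c < 1, so that 1 - c can be the ratio. *)
have c1 : 0 < 1 - c.
  have := dec K (leqnn _); have := r0 K (leqnn _); have := r0 K.+1 (leqnSn _).
  nra.
have tk k : 0 < (1 - c) ^+ k by rewrite exprn_gt0.
exists (r K / (1 - c) ^+ K), (1 - c); split.
- by rewrite divr_gt0// r0.
- by rewrite c1/= gtrBl.
move=> k Kk; rewrite -(subnKC Kk) exprD mulrA divfK ?gt_eqF//.
elim: (k - K)%N => [|j IH]; first by rewrite addn0 mulr1.
rewrite addnS (le_trans (dec _ (leq_addr _ _)))//.
rewrite exprS mulrCA -[X in X - _]mul1r -mulrBl ler_pM2l//.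
Qed.

(** By the tangent inequality r^(-s) grows by at least s c per step, hence at least linearly in
    k. *)
Lemma sublinear_rate (R : realType) (r : nat -> R) (c s : R) (K : nat) :
  0 < c -> 0 < s -> (forall k, (K <= k)%N -> 0 < r k) ->
  (forall k, (K <= k)%N -> r k.+1 <= r k - c * r k `^ (1 + s)) ->
  exists C : R, 0 < C /\ exists N, forall k, (N <= k)%N -> r k <= C * k%:R `^ (- s^-1).
Proof.
move=> c0 s0 r0 dec.
have grow j : j%:R * (s * c) <= r (K + j)%N `^ (- s).
  elim: j => [|j IH]; first by rewrite mul0r powR_ge0.
  have Kj : (K <= K + j)%N by exact: leq_addr.
  have rj := r0 _ Kj; have rj1 := r0 _ (leqW Kj); have := dec _ Kj.
  have cr : 0 < c * r (K + j)%N `^ (1 + s) by rewrite mulr_gt0 ?powR_gt0.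
  move=> dj; have le : r (K + j).+1 <= r (K + j)%N by lra.
  have := powRN_convex_tangent s0 rj1 le.
  have : s * (c * r (K + j)%N `^ (1 + s)) * r (K + j)%N `^ (- s - 1) <=
         s * (r (K + j)%N - r (K + j).+1) * r (K + j)%N `^ (- s - 1).
    by rewrite ler_wpM2r ?powR_ge0// ler_pM2l//; lra.
  rewrite -!mulrA -powRD ?(gt_eqF rj) ?implybT//.
  have -> : 1 + s + (- s - 1) = 0 by ring.
  rewrite powRr0 addnS -natr1; lra.
exists ((s * c / 2) `^ (- s^-1)); split; first by rewrite powR_gt0 ?divr_gt0 ?mulr_gt0.
(* From 2 K on, k - K is at least k/2, whence the halved constant; the successor makes k
   positive. *)
exists (2 * K).+1 => k Kk.
have kK : (K <= k)%N by rewrite (leq_trans _ (ltnW Kk))// leq_pmull.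
have k0 : 0 < k%:R :> R by rewrite ltr0n (leq_ltn_trans _ Kk).
have rk := r0 _ kK.
have lo : s * c / 2 * k%:R <= r k `^ (- s).
  have := grow (k - K)%N; rewrite subnKC//; apply: le_trans.
  have : 0 <= s * c * (k%:R - (2 * K)%:R).
    by rewrite mulr_ge0 ?mulr_ge0 ?(ltW s0) ?(ltW c0)// subr_ge0 ler_nat ltnW.
  rewrite natrB// natrM; lra.
rewrite -powRM ?(ltW k0) ?divr_ge0 ?mulr_ge0 ?(ltW s0) ?(ltW c0)//.
have -> : r k = (r k `^ (- s)) `^ (- s^-1).
  by rewrite -powRrM mulrNN mulfV ?gt_eqF// powRr1// ltW.
rewrite !(powRN _ s^-1) lef_pV2 ?posrE ?powR_gt0 ?mulr_gt0 ?divr_gt0//.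
apply: ge0_ler_powR => //; rewrite ?nnegrE ?invr_ge0 ?powR_ge0 ?mulr_ge0 ?divr_ge0 ?(ltW s0) ?(ltW c0) ?(ltW k0)//.
Qed.

(** * Inexact gradient descent *)

Section inexact_gradient_descent.
Context {R : realType} {m : nat}.
Variables (F : 'cV[R]_m -> R) (G : 'cV[R]_m -> 'cV[R]_m) (lambda mu : R).
Variables (y v : nat -> 'cV[R]_m) (eps : nat -> R).
Hypothesis F_lower : forall z w, F z + inner (G z) (w - z) <= F w.
Hypothesis F_upper : forall z w,
  F w <= F z + inner (G z) (w - z) + (2 * lambda)^-1 * enorm (w - z) ^+ 2.
Hypotheses (lambda_gt0 : 0 < lambda) (mu_gt2 : 2 < mu).
Hypothesis y_step : forall k, (1 <= k)%N -> y k.+1 = y k - lambda *: v k.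
Hypothesis v_error : forall k, (1 <= k)%N -> enorm (v k - G (y k)) <= eps k.
Hypothesis v_large : forall k, (1 <= k)%N -> mu * eps k < enorm (v k).
Hypothesis eps_gt0 : forall k, (1 <= k)%N -> 0 < eps k.

(** Guaranteed decrease of F relative to |v k|^2: lambda from the linear term, less lambda/2 from
    the quadratic one and lambda/mu from the gradient error. It is positive because mu > 2. *)
Let kap : R := lambda * (2^-1 - mu^-1).

Let kap_gt0 : 0 < kap.
Proof. by rewrite mulr_gt0// subr_gt0 ltf_pV2 ?posrE// (lt_trans _ mu_gt2). Qed.

Let y_diff k : (1 <= k)%N -> y k.+1 - y k = - (lambda *: v k).
Proof. by move=> k1; rewrite y_step// addrAC subrr add0r. Qed.

Let v_gt0 k : (1 <= k)%N -> 0 < enorm (v k).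
Proof.
move=> k1; apply: lt_trans (v_large k1); rewrite mulr_gt0 ?eps_gt0//.
exact: lt_trans mu_gt2.
Qed.

Lemma inexact_descent k : (1 <= k)%N -> F (y k.+1) <= F (y k) - kap * enorm (v k) ^+ 2.
Proof.
move=> k1; have := F_upper (y k) (y k.+1); rewrite y_diff//.
rewrite innerNr innerZr enormN enormZ exprMn real_normK ?num_real//.
have -> : (2 * lambda)^-1 * (lambda ^+ 2 * enorm (v k) ^+ 2) = lambda / 2 * enorm (v k) ^+ 2.
  by field; rewrite gt_eqF.
have vmu : eps k <= mu^-1 * enorm (v k).
  by rewrite mulrC ler_pdivlMr ?(lt_trans _ mu_gt2)// mulrC ltW// v_large.
have : inner (v k - G (y k)) (v k) <= mu^-1 * enorm (v k) * enorm (v k).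
  apply: le_trans (inner_le_enorm _ _) _.
  by rewrite ler_wpM2r ?enorm_ge0// (le_trans (v_error k1)).
rewrite innerDl innerNl -enorm_sqr -mulrA -expr2 /kap.
move: (mu^-1) (enorm (v k) ^+ 2) => M V H le.
have {}H : lambda * (V - inner (G (y k)) (v k)) <= lambda * (M * V).
  by rewrite ler_pM2l.
lra.
Qed.

Lemma gradient_le_step k : (1 <= k)%N -> enorm (G (y k)) <= 2 * enorm (v k).
Proof.
move=> k1; have := v_large k1; have := v_error k1; have := eps_gt0 k1.
have := ler_enormD (G (y k) - v k) (v k).
rewrite subrK (enormB (G (y k)) (v k)) => GE e0 vG ve.
have : 2 * eps k < mu * eps k by rewrite ltr_pM2r.
lra.
Qed.

Let value_decr k : (1 <= k)%N -> F (y k.+1) < F (y k).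
Proof.
move=> k1; have := inexact_descent k1.
have : 0 < kap * enorm (v k) ^+ 2 by rewrite mulr_gt0// exprn_gt0// v_gt0.
lra.
Qed.

Let value_decrW j k : (1 <= j)%N -> (j <= k)%N -> F (y k) <= F (y j).
Proof.
move=> j1 jk; rewrite -(subnKC jk); elim: (k - j)%N => [|d IH]; first by rewrite addn0.
by rewrite addnS (le_trans _ IH)// ltW// value_decr// (leq_trans j1)// leq_addr.
Qed.

(** Decreasing values bounded below have drops tending to 0, and each drop is at least kap |v
    k|^2. *)
Lemma step_vanishes (B : R) : (forall k, (1 <= k)%N -> B <= F (y k)) ->
  forall s, 0 < s -> exists N, forall k, (N <= k)%N -> enorm (v k) < s.
Proof.
move=> FB s s0.
have ks : 0 < kap * s ^+ 2 by rewrite mulr_gt0// exprn_gt0.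
have [|N N1 NP] := @nonincreasing_tail _ (F \o y) 1 B _ FB _ ks.
  by move=> k k1; exact/ltW/value_decr.
exists N => k Nk; have k1 := leq_trans N1 Nk.
rewrite -(@ltr_pXn2r _ 2) ?nnegrE ?enorm_ge0 ?(ltW s0)// -(ltr_pM2l kap_gt0).
have := NP k k.+1 Nk isT; have := inexact_descent k1; rewrite /=; lra.
Qed.

(** The affine minorant of F at 0 is bounded below on the ball containing the iterates. *)
Lemma bounded_step_vanishes (B : R) : (forall k, (1 <= k)%N -> enorm (y k) <= B) ->
  forall s, 0 < s -> exists N, forall k, (N <= k)%N -> enorm (v k) < s.
Proof.
move=> yB; apply: (@step_vanishes (F 0 - enorm (G 0) * B)) => k k1.
apply: le_trans (F_lower 0 (y k)); rewrite subr0 lerD2l lerNl -innerNl.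
apply: le_trans (inner_le_enorm _ _) _; rewrite enormN.
by rewrite ler_wpM2l ?enorm_ge0// yB.
Qed.

(** * Iterates with an accumulation point: minimality, KL convergence and rates *)

Section accumulation.
Variable ybar : 'cV[R]_m.
Hypothesis y_acc : accumulation_point y ybar.

Let acc := cluster_enormP y_acc.

Lemma value_near e N : 0 < e -> exists2 k, (N <= k)%N & `|F (y k) - F ybar| < e.
Proof.
(* At distance at most 1 from ybar the quadratic bounds become linear ones with slope c. *)
move=> e0; pose c := enorm (G ybar) + (2 * lambda)^-1.
have c0 : 0 <= c by rewrite addr_ge0 ?enorm_ge0 ?invr_ge0 ?mulr_ge0 ?ltW.
have d0 : 0 < Num.min 1 (e / (c + 1)) by rewrite lt_min ltr01 divr_gt0// ltr_wpDl.
have [k Nk] := acc N d0; rewrite lt_min => /andP[k1]; rewrite ltr_pdivlMr ?ltr_wpDl// => ke.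
exists k => //; apply: le_lt_trans (_ : enorm (y k - ybar) * c < e); last first.
  have := enorm_ge0 (y k - ybar); lra.
have d2 : enorm (y k - ybar) ^+ 2 <= enorm (y k - ybar).
  by rewrite expr2 -[leRHS]mulr1 ler_wpM2l ?enorm_ge0// ltW.
have lo := F_lower ybar (y k); have up := F_upper ybar (y k).
have := inner_le_norm (G ybar) (y k - ybar); rewrite ler_norml => /andP[i1 i2].
have l0 : 0 <= (2 * lambda)^-1 by rewrite invr_ge0 mulr_ge0// ltW.
have {}d2 := ler_wpM2l l0 d2; have d3 := mulr_ge0 l0 (enorm_ge0 (y k - ybar)).
move: d2 d3 up; rewrite /c; move: ((2 * lambda)^-1) => l d2 d3 up.
by rewrite ler_norml; apply/andP; split; lra.
Qed.

Lemma value_ge_limit k : (1 <= k)%N -> F ybar <= F (y k).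
Proof.
move=> k1; apply/ler_addgt0Pl => e e0.
have [j kj] := value_near k e0; rewrite ltr_norml => /andP[j1 j2].
have := value_decrW k1 kj; lra.
Qed.

(** Strictness is what makes the KL inequality applicable at every late iterate near ybar. *)
Lemma value_gt_limit k : (1 <= k)%N -> F ybar < F (y k).
Proof.
by move=> k1; rewrite (le_lt_trans (value_ge_limit (leqW k1)))// value_decr.
Qed.

Lemma value_cvg e : 0 < e ->
  exists2 N, (1 <= N)%N & forall k, (N <= k)%N -> F (y k) < F ybar + e.
Proof.
move=> e0; have [N N1] := value_near 1 e0; rewrite ltr_norml => /andP[j1 j2].
exists N => // k Nk; have := value_decrW N1 Nk; lra.
Qed.

(** The subgradient inequality is used at iterates near ybar, where |G (y k)| <= 2 |v k| is small,
    so F z cannot lie visibly below F (y k) >= F ybar. *)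
Lemma accumulation_is_min z : F ybar <= F z.
Proof.
rewrite -subr_le0.
apply: (@le0_of_le_small _ _ (2 * (enorm (z - ybar) + 1))).
  by rewrite mulr_ge0// addr_ge0 ?enorm_ge0.
move=> s /andP[s0 s1].
have [N NP] := step_vanishes value_ge_limit s0.
have [k Nk yk] := acc (maxn 1 N) ltr01.
have k1 : (1 <= k)%N := leq_trans (leq_maxl _ _) Nk.
have vk := NP k (leq_trans (leq_maxr _ _) Nk).
have := F_lower (y k) z; have := value_ge_limit k1.
have : - inner (G (y k)) (z - y k) <= 2 * s * (enorm (z - ybar) + 1).
  rewrite -innerNl; apply: le_trans (inner_le_enorm _ _) _; rewrite enormN.
  rewrite ler_pM ?enorm_ge0//.
    by apply: le_trans (gradient_le_step k1) _; rewrite ler_pM2l// ltW.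
  by apply: le_trans (ler_enorm_distD ybar _ _) _; rewrite lerD2l enormB ltW.
lra.
Qed.

(** [Psi] is kept abstract so that it can be either the integral of 1/psi or a closed form from
    which rates can be read off. *)
Lemma KL_descent (eta : R) (U : set 'cV[R]_m) (psi Psi : R -> R) :
  0 < eta -> nbhs ybar U ->
  (forall t, 0 < t < eta -> 0 < psi t) ->
  (forall t, 0 < t < eta -> 0 <= Psi t) ->
  (forall s t, 0 < s -> s <= t -> t < eta -> (t - s) / psi t <= Psi t - Psi s) ->
  (forall z, U z -> F ybar < F z < F ybar + eta -> psi (F z - F ybar) <= enorm (G z)) ->
  y @ \oo --> ybar /\
  exists C c : R, [/\ 0 < C, 0 < c & exists2 N, (1 <= N)%N & forall k, (N <= k)%N ->
    let r j := F (y j) - F ybar in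
    [/\ 0 < r k < eta, enorm (y k - ybar) <= C * Psi (r k)
      & r k.+1 <= r k - c * psi (r k) ^+ 2]].
Proof.
move=> eta0 /nbhs_enormP[rho rho0 rhoU] psi0 Psi0 Psi_tan KL.
pose r j := F (y j) - F ybar.
have [K K1 KP] := value_cvg eta0.
have rE k : (K <= k)%N -> 0 < r k < eta.
  move=> Kk; have := KP k Kk; have := value_gt_limit (leq_trans K1 Kk).
  by rewrite /r => h1 h2; apply/andP; split; lra.
have rdec k : (K <= k)%N -> r k.+1 < r k.
  by move=> Kk; have := value_decr (leq_trans K1 Kk); rewrite /r; lra.
have psiv k : (K <= k)%N -> enorm (y k - ybar) < rho -> psi (r k) <= 2 * enorm (v k).
  move=> Kk yk; have k1 := leq_trans K1 Kk.
  apply: le_trans (gradient_le_step k1); apply: KL; first exact: rhoU.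
  by rewrite value_gt_limit//= KP.
(* Descent, tangent inequality and KL inequality give kap |v|^2 <= 2 |v| times the drop of Psi;
   cancelling |v| bounds the step lambda |v| by C times that drop. *)
pose C := 2 * lambda / kap.
have C0 : 0 < C by rewrite divr_gt0// mulr_gt0.
have Psidec k : (K <= k)%N -> (r k - r k.+1) / psi (r k) <= Psi (r k) - Psi (r k.+1).
  move=> Kk; have /andP[_ rk] := rE _ Kk; have /andP[rk1 _] := rE _ (leqW Kk).
  by apply: Psi_tan => //; exact/ltW/rdec.
have [||||ycvg [N NP]] := @finite_length_trap _ _ y ybar rho (fun k => C * Psi (r k)) K rho0.
- by move=> k Kk; rewrite mulr_ge0 ?(ltW C0)// Psi0// rE.
- move=> k Kk; rewrite ler_pM2l// -subr_ge0; apply: le_trans (Psidec k Kk).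
  by rewrite divr_ge0// ?subr_ge0 ltW// ?rdec// psi0 ?rE.
- move=> k Kk yk; have k1 := leq_trans K1 Kk.
  rewrite y_diff// enormN enormZ gtr0_norm// -mulrBr.
  have := Psidec k Kk; rewrite ler_pdivrMr ?psi0 ?rE// => H.
  have /andP[_ rk] := rE _ Kk.
  have D0 : 0 <= Psi (r k) - Psi (r k.+1).
    apply: le_trans (Psidec k Kk).
    by rewrite divr_ge0// ?subr_ge0 ltW// ?rdec// psi0 ?rE.
  have {}H : kap * enorm (v k) ^+ 2 <= (Psi (r k) - Psi (r k.+1)) * (2 * enorm (v k)).
    apply: le_trans (ler_wpM2l D0 (psiv k Kk yk)); apply: le_trans H.
    by have := inexact_descent k1; rewrite /r; lra.
  have {}H : kap * enorm (v k) <= 2 * (Psi (r k) - Psi (r k.+1)).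
    by rewrite -(ler_pM2r (v_gt0 k1)); move: H; rewrite expr2; lra.
  rewrite /C mulrAC ler_pdivlMr//; have := ler_wpM2l (ltW lambda_gt0) H.
  by move: (Psi _ - Psi _) => D; lra.
- by [].
split=> //.
have [N' NP'] := (cvg_enormP _ _).1 ycvg _ rho0.
(* The factor 1/4 comes from squaring psi(r k) <= 2 |v k|. *)
exists C, (kap / 4); split=> //; first by rewrite divr_gt0.
exists (maxn K (maxn N N')); first by rewrite (leq_trans K1)// leq_maxl.
move=> k; rewrite !geq_max => /and3P[Kk Nk N'k]; rewrite -/(r k); split.
- exact: rE.
- exact: NP.
have := inexact_descent (leq_trans K1 Kk); rewrite /r.
have h := psiv k Kk (NP' k N'k); have p0 := psi0 _ (rE k Kk).
have : kap / 4 * psi (r k) ^+ 2 <= kap / 4 * (2 * enorm (v k)) ^+ 2.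
  by rewrite ler_pM2l ?divr_gt0// ler_pXn2r ?nnegrE ?(ltW p0) ?mulr_ge0 ?enorm_ge0.
rewrite /r; lra.
Qed.

Lemma KL_convergence (psi : R -> R) : KL_with F ybar psi ->
  (forall z, gradient F z = G z) -> y @ \oo --> ybar.
Proof.
move=> [eta [U [eta0 ybarU [psi0 psi_nd] psi_int KL]]] FG.
have [Psi [Psi0 Psi_tan]] := desingularizing_integral psi0 psi_nd psi_int.
by have [|] := KL_descent eta0 ybarU psi0 Psi0 Psi_tan; first by move=> z; rewrite -FG; exact: KL.
Qed.

Lemma KL_power_rates (M q : R) : 0 < M -> 0 < q < 1 ->
  KL_with F ybar (fun t => M * t `^ q) -> (forall z, gradient F z = G z) ->
  (q <= 1 / 2 -> converges_linearly y ybar) /\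
  (1 / 2 < q -> exists C : R, 0 < C /\ exists N, forall k, (N <= k)%N ->
     enorm (y k - ybar) <= C * k%:R `^ (- ((1 - q) / (2 * q - 1)))).
Proof.
move=> M0 /andP[q0 q1] [eta [U [eta0 ybarU [psi0 _] _ KL]]] FG.
have q10 : 0 < 1 - q by rewrite subr_gt0.
have Mq : 0 < M * (1 - q) by rewrite mulr_gt0.
(* The antiderivative of 1/(M t^q) vanishing at 0; it makes the distance to ybar at most a multiple
   of r^(1 - q). *)
pose Psi t := t `^ (1 - q) / (M * (1 - q)).
have Psi0 t : 0 < t < eta -> 0 <= Psi t.
  by move=> _; rewrite divr_ge0 ?powR_ge0// ltW.
have Psi_tan s t : 0 < s -> s <= t -> t < eta -> (t - s) / (M * t `^ q) <= Psi t - Psi s.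
  move=> s0 st _; have t0 : 0 < t := lt_le_trans s0 st.
  rewrite /Psi -mulrBl ler_pdivlMr//.
  have p01 : 0 < 1 - q < 1 by rewrite q10 gtrBl.
  apply: le_trans (powR_concave_tangent p01 s0 st).
  rewrite addrAC subrr add0r powRN.
  have tq : 0 < t `^ q by rewrite powR_gt0.
  by rewrite le_eqVlt; apply/orP; left; apply/eqP; field; rewrite !gt_eqF.
have [|_ [C [c [C0 c0 [N N1 NP]]]]] := KL_descent eta0 ybarU psi0 Psi0 Psi_tan.
  by move=> z; rewrite -FG; exact: KL.
pose r j := F (y j) - F ybar.
have r0 k : (N <= k)%N -> 0 < r k by move=> /NP[/andP[]].
pose D := C / (M * (1 - q)).
have D0 : 0 < D by rewrite divr_gt0.
have yr k : (N <= k)%N -> enorm (y k - ybar) <= D * r k `^ (1 - q).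
  by move=> /NP[_ + _]; rewrite /Psi -/(r k) mulrCA mulrC -/D mulrC.
have rdec k : (N <= k)%N -> r k.+1 <= r k - c * M ^+ 2 * r k `^ (1 + (2 * q - 1)).
  move=> Nk; have [_ _] := NP k Nk; rewrite -/(r k) exprMn -[(r k `^ q) ^+ 2]powR_mulrn ?powR_ge0//.
  by rewrite -powRrM mulrA (_ : q * 2 = 1 + (2 * q - 1))//; ring.
have cM : 0 < c * M ^+ 2 by rewrite mulr_gt0// exprn_gt0.
split=> [qle|qgt].
  (* Once r is below 1, the exponent 2 q <= 1 gives r^(2q) >= r, and the decrease becomes linear. *)
  have [N2 _ NP2] := value_cvg ltr01.
  have [] := @linear_rate _ r (c * M ^+ 2) (maxn N N2) cM.
  - by move=> k; rewrite geq_max => /andP[/r0].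
  - move=> k; rewrite geq_max => /andP[Nk N2k]; apply: le_trans (rdec k Nk) _.
    rewrite lerD2l lerN2 ler_pM2l//; apply: ger1_powR.
      by rewrite r0//=; have := NP2 k N2k; rewrite /r; lra.
    lra.
  move=> C' [t [C'0 /andP[t0 t1] rC]].
  exists (D * C' `^ (1 - q)), (t `^ (1 - q)); split.
  - by rewrite mulr_gt0 ?powR_gt0.
  - rewrite powR_gt0//=; have := @gt0_ltr_powR _ _ q10 t 1.
    by rewrite !nnegrE powR1 ler01 (ltW t0); apply.
  exists (maxn N N2) => // k /= Nk; apply: le_trans (yr k (leq_trans (leq_maxl _ _) Nk)) _.
  have -> : (t `^ (1 - q)) ^+ k = (t ^+ k) `^ (1 - q).
    by rewrite -!powR_mulrn ?powR_ge0 ?(ltW t0)// powRAC.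
  rewrite -mulrA ler_pM2l// -powRM ?(ltW C'0) ?exprn_ge0 ?(ltW t0)//.
  have rk := r0 k (leq_trans (leq_maxl _ _) Nk).
  apply: ge0_ler_powR; rewrite ?nnegrE ?(ltW q10) ?(ltW rk)//.
    by rewrite mulr_ge0 ?exprn_ge0 ?ltW.
  exact: rC.
have s0 : 0 < 2 * q - 1 by lra.
have [C' [C'0 [N2 rC]]] := sublinear_rate cM s0 r0 rdec.
exists (D * C' `^ (1 - q)); split; first by rewrite mulr_gt0 ?powR_gt0.
exists (maxn N N2) => k; rewrite geq_max => /andP[Nk N2k].
apply: le_trans (yr k Nk) _; rewrite -mulrA ler_pM2l//.
have -> : - ((1 - q) / (2 * q - 1)) = - (2 * q - 1)^-1 * (1 - q) by rewrite mulNr mulrC.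
rewrite powRrM -powRM ?(ltW C'0) ?powR_ge0//.
apply: ge0_ler_powR; rewrite ?nnegrE ?(ltW q10) ?(ltW (r0 k Nk))//.
  by rewrite mulr_ge0 ?powR_ge0// ltW.
exact: rC.
Qed.

End accumulation.

End inexact_gradient_descent.

(** * The augmented Lagrangian method *)

Lemma inner_mulmx (R : realType) (n m : nat) (A : 'M[R]_(m, n)) (w : 'cV[R]_m) (u : 'cV[R]_n) :
  inner w (A *m u) = inner (A^T *m w) u.
Proof.
have innerE' p (a c : 'cV[R]_p) : inner a c = (a^T *m c) 0 0.
  by rewrite mxE; apply: eq_bigr => i _; rewrite mxE.
by rewrite !innerE' trmx_mul trmxK mulmxA.
Qed.

(** For w = b - A xbar, |w|^2 = <w, b - A x_k> + <A^T w, x_k - xbar>, and both terms become small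
    together along suitable indices. *)
Lemma residual_of_cluster (R : realType) (n m : nat) (A : 'M[R]_(m, n)) (b : 'cV[R]_m)
    (x : nat -> 'cV[R]_n) (xbar : 'cV[R]_n) :
  accumulation_point x xbar ->
  (forall s, 0 < s -> exists N, forall k, (N <= k)%N -> enorm (b - A *m x k) < s) ->
  A *m xbar = b.
Proof.
move=> /cluster_enormP acc res0.
suff : enorm (b - A *m xbar) ^+ 2 <= 0.
  move=> le0; apply/esym/eqP; rewrite -subr_eq0; apply/eqP/enorm_eq0/eqP.
  by rewrite -sqrf_eq0 eq_le le0 sqr_ge0.
set w := b - _.
apply: (@le0_of_le_small _ _ (enorm w + enorm (A^T *m w))); first by rewrite addr_ge0 ?enorm_ge0.
move=> s /andP[s0 _]; have [N NP] := res0 s s0; have [k Nk xk] := acc s N s0.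
have wE : w = (b - A *m x k) + A *m (x k - xbar).
  by rewrite mulmxBr addrA subrK.
rewrite enorm_sqr {2}wE innerDr inner_mulmx mulrDr ![s * _]mulrC.
by apply: lerD; apply: le_trans (inner_le_enorm _ _) _; rewrite ler_wpM2l ?enorm_ge0// ltW// NP.
Qed.

(** Any real c below h(xbar) stays below h near xbar, hence c <= a. If h(xbar) exceeded a, the
    midpoint, or a + 1 when h(xbar) is infinite, would contradict this. *)
Lemma lsc_cluster_le (R : realType) (n : nat) (h : 'cV[R]_n -> \bar R)
    (x : nat -> 'cV[R]_n) (xbar : 'cV[R]_n) (a C : R) :
  lower_semicontinuous h -> accumulation_point x xbar -> 0 <= C ->
  (forall s, 0 < s < 1 -> exists N, forall k, (N <= k)%N -> (h (x k) <= (a + s * C)%:E)%E) ->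
  (h xbar <= a%:E)%E.
Proof.
move=> h_lsc acc C0 hx.
have below c : (c%:E < h xbar)%E -> c <= a.
  move=> /h_lsc[V /nbhs_enormP[e e0 eV] hV]; rewrite -subr_le0.
  apply: (le0_of_le_small C0) => s /hx[N NP].
  have [k Nk xk] := cluster_enormP acc N e0.
  have := lt_le_trans (hV _ (eV _ xk)) (NP k Nk); rewrite lte_fin; lra.
rewrite leNgt; apply/negP => lt.
case E : (h xbar) lt below => [r| |]//.
- rewrite lte_fin => ar /(_ ((a + r) / 2)); rewrite lte_fin => H.
  by have := H (midf_lt ar).2; lra.
- by move=> _ /(_ (a + 1) (ltry _)); lra.
Qed.

Theorem theorem4p8 (R : realType) (n m : nat)
    (h : 'cV[R]_n -> \bar R) (A : 'M[R]_(m, n)) (b : 'cV[R]_m)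
    (h_proper : proper_fun h) (h_lsc : lower_semicontinuous h)
    (h_convex : convex_efun h)
    (feasible : exists x, A *m x = b)
    (lambda theta mu : R)
    (x : nat -> 'cV[R]_n) (y : nat -> 'cV[R]_m) (eps : nat -> R)
    (i : nat -> nat)
    (xy_gialm : gialm h A b lambda theta mu x y eps i)
    (sup_dual : (-oo < ereal_sup (range (dual h A b)))%E)
    (y_not_sol : forall k, (1 <= k)%N -> ~ dual_solution h A b (y k)) :
  let g := fun w => (- dual h A b w)%E in
  let env := fun w => fine (moreau lambda g w) in
  (enorm (y k) @[k --> \oo] --> +oo) \/
  [/\ (forall ybar, accumulation_point y ybar -> dual_solution h A b ybar) /\
      ((exists B : R, forall k, (1 <= k)%N -> enorm (y k) <= B) ->
        forall xbar, accumulation_point x xbar -> primal_solution h A b xbar),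
      forall ybar, accumulation_point y ybar -> KL_property env ybar ->
        y @ \oo --> ybar
    & forall (ybar : 'cV[R]_m) (M q : R),
        accumulation_point y ybar -> 0 < M -> 0 < q < 1 ->
        KL_with env ybar (fun t => M * t `^ q) ->
        (q <= 1 / 2 -> converges_linearly y ybar) /\
        (1 / 2 < q ->
          (fun k => enorm (y k - ybar))
          =O_\oo (fun k => k%:R `^ (- ((1 - q) / (2 * q - 1)))))].
Proof.
move=> g env; right.
case: xy_gialm => lambda0 /andP[theta0 theta1] mu2 eps1 xP yP epsP.
have [G] := moreau_dual_smooth h_proper h_convex lambda0 sup_dual.
rewrite -/g -/env => -[F_lower F_upper infE approxE min_sol].
have eps_gt0 k : (1 <= k)%N -> 0 < eps k.
  elim: k => // -[|k] IH _ //; rewrite epsP// mulr_gt0 ?exprn_gt0//; exact: IH.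
have deltaE k : (1 <= k)%N ->
    lambda * theta ^+ (2 * i k) * eps k ^+ 2 / 2 = lambda * eps k.+1 ^+ 2 / 2.
  by move=> k1; rewrite epsP// exprMn -exprM (mulnC 2 (i k)) !mulrA.
(* The step from [y k] uses [x k.+1], and its final tolerance theta^(i k) eps k is [eps k.+1]; the
   descent lemmas are thus applied to [eps] shifted by one. *)
pose v k := b - A *m x k.+1.
have ystep k : (1 <= k)%N -> y k.+1 = y k - lambda *: v k.
  by move=> k1; rewrite yP// /v -scalerN opprB.
have approx k : (1 <= k)%N ->
    approx_minimizer h A b lambda (y k) (lambda * eps k.+1 ^+ 2 / 2) (x k.+1).
  by move=> k1; have [z [zP _ _ ->]] := xP k k1; rewrite -deltaE//; exact: zP.
have v_error k : (1 <= k)%N -> enorm (v k - G (y k)) <= eps k.+1.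
  move=> k1; rewrite -(@ler_pXn2r _ 2) ?nnegrE ?enorm_ge0 ?(ltW (eps_gt0 _ _))//.
  apply: le_trans (approxE _ _ _ (approx k k1)) _.
  by rewrite le_eqVlt; apply/orP; left; apply/eqP; field; rewrite gt_eqF.
have v_large k : (1 <= k)%N -> mu * eps k.+1 < enorm (v k).
  by move=> k1; have [z [_ _ + xz]] := xP k k1; rewrite /v xz epsP// mulrA.
have eps1_gt0 k : (1 <= k)%N -> 0 < eps k.+1 by move=> _; exact: eps_gt0.
have gradE z : gradient env z = G z.
  exact: gradient_of_quadratic_bounds (F_lower z) (F_upper z).
split; first split.
- move=> ybar acc; apply: min_sol => z.
  exact: (accumulation_is_min F_lower F_upper lambda0 mu2 ystep v_error v_large eps1_gt0 acc).
- move=> [B yB] xbar acc.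
  have v0 := bounded_step_vanishes F_lower F_upper lambda0 mu2 ystep v_error v_large eps1_gt0 yB.
  have x0 s : 0 < s -> exists N, forall k, (N <= k)%N -> enorm (b - A *m x k) < s.
    by move=> /v0[N NP]; exists N.+1 => -[//|k] /NP.
  split; first exact: residual_of_cluster acc x0.
  move=> z Az; have B0 : 0 <= B := le_trans (enorm_ge0 _) (yB 1%N isT).
  have [|[a hz]] : h z = +oo%E \/ exists a, h z = a%:E.
  - by have := h_proper.1 z; case: (h z) => [a| |]//; [right; exists a|left].
  - by move=> ->; rewrite leey.
  (* For feasible z the Lagrangian equals h z, so near-minimality bounds h(x_(k+1)) by a plus two
     errors: <y_k, v_k> <= B s, and a tolerance of at most lambda/2 s because eps^2 <= |v_k|^2 <=
     s. *)
  rewrite hz; apply: (@lsc_cluster_le _ _ _ x xbar a (lambda / 2 + B) h_lsc acc).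
    by rewrite addr_ge0// divr_ge0// ltW.
  move=> s /andP[s0 s1]; have [N NP] := v0 s s0.
  (* The shift by two makes k both larger than N and at least 1, where [x k.+1] comes from the
     algorithm. *)
  exists N.+2 => -[//|k]; rewrite ltnS => Nk.
  have k1 : (1 <= k)%N by exact: leq_trans Nk.
  have vs := NP k (ltnW Nk).
  have le_a : (- env (y k) <= a)%R.
    rewrite -lee_fin -infE -hz.
    have -> : h z = aug_lagrangian h A b lambda z (y k).
      rewrite /aug_lagrangian Az subrr enorm0 expr0n mulr0 adde0.
      by rewrite -[X in inner _ X](scale0r b) innerZr mul0r adde0.
    by apply: ereal_inf_lbound; exists z.
  have := approx k k1; rewrite /approx_minimizer infE /aug_lagrangian.
  have -> : A *m x k.+1 - b = - v k by rewrite opprB.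
  rewrite innerNr enormN.
  case: (h (x k.+1)) => [c| |] //; last by move=> _; exact: leNye.
  rewrite -!EFinD !lee_fin => H.
  have ve : eps k.+1 ^+ 2 <= enorm (v k) ^+ 2.
    rewrite ler_pXn2r ?nnegrE ?enorm_ge0 ?(ltW (eps_gt0 _ _))//.
    by have := v_large k k1; have := eps1_gt0 k k1; nra.
  have vv : enorm (v k) ^+ 2 <= s.
    by have := enorm_ge0 (v k); nra.
  have yv : inner (y k) (v k) <= B * s.
    apply: le_trans (inner_le_enorm _ _) _.
    by apply: ler_pM; rewrite ?enorm_ge0// ?yB// ltW.
  have : lambda * eps k.+1 ^+ 2 <= lambda * enorm (v k) ^+ 2 by rewrite ler_pM2l.
  have : 0 <= lambda * enorm (v k) ^+ 2 by rewrite mulr_ge0 ?sqr_ge0// ltW.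
  have : lambda * enorm (v k) ^+ 2 <= lambda * s by rewrite ler_pM2l.
  lra.
- move=> ybar acc [psi KL].
  exact: (KL_convergence F_lower F_upper lambda0 mu2 ystep v_error v_large eps1_gt0 acc KL gradE).
- move=> ybar M q acc M0 q01 KL.
  have [lin sub] := KL_power_rates F_lower F_upper lambda0 mu2 ystep v_error v_large eps1_gt0
    acc M0 q01 KL gradE.
  split=> // /sub[C [C0 [N NP]]].
  apply/eqO_exP; exists C => //; exists N => // k /= /NP.
  by rewrite ger0_norm ?enorm_ge0// ger0_norm// powR_ge0.
Qed.
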